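(* $\tilde t(1)=2$.
   Context: Let $\mathfrak{C}=\{0,1\}^n$ be the vertex set of the $n$-dimensional hypercube; $\oplus,\wedge$ denote bitwise XOR and AND. An outmap is any function $s:\mathfrak{C}\to\{0,1\}^n$. A clash of $s$ is a pair of distinct vertices $u,v$ with $(s(u)\oplus s(v))\wedge(u\oplus v)=0^n$. A query at $u$ to the oracle for $s$ returns $s(u)$; algorithms choose queries adaptively, and only the number of queries is counted. \textsc{Sink-or-Clash}: given oracle access to an arbitrary outmap $s$, query either a vertex $u$ with $s(u)=0^n$ or both vertices of some clash. $\tilde t(n)=\min_{\mathcal A}\max_s \mathbb E[\tilde t(\mathcal A,s)]$, where $\mathcal A$ ranges over randomized algorithms solving \textsc{Sink-or-Clash} on all outmaps $s$ of the $n$-cube and $\tilde t(\mathcal A,s)$ is the random number of queries made on $s$. *)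

(* Defs.v *)
From HB Require Import structures.
From mathcomp Require Import all_boot all_order all_algebra.
From mathcomp Require Import all_classical all_reals all_analysis.
Set Implicit Arguments.
Unset Strict Implicit.
Unset Printing Implicit Defensive.
Import Order.TTheory GRing.Theory Num.Theory.
Local Open Scope classical_set_scope.
Local Open Scope ring_scope.

Definition word (n : nat) := {ffun 'I_n -> bool}.

Definition zerow n : word n := [ffun=> false].
Definition xorw n (u v : word n) : word n := [ffun i => u i (+) v i].
Definition andw n (u v : word n) : word n := [ffun i => u i && v i].

Definition outmap (n : nat) := {ffun word n -> word n}.

Definition sink n (s : outmap n) (u : word n) : bool := s u == zerow n.

Definition clash n (s : outmap n) (u v : word n) : bool :=
  (u != v) && (andw (xorw (s u) (s v)) (xorw u v) == zerow n).

(* The queries made so far with their answers, oldest first. *)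
Definition history (n : nat) := seq (word n * word n).

(* A deterministic adaptive algorithm: [Some u] queries [u], [None] halts.
   Repeated queries are allowed, and each is counted. *)
Definition strategy (n : nat) := history n -> option (word n).

Fixpoint transcript n (a : strategy n) (s : outmap n) (k : nat) : history n :=
  if k is k'.+1 then
    let h := transcript a s k' in
    if a h is Some u then rcons h (u, s u) else h
  else [::].

Definition succeeds n (s : outmap n) (h : history n) : Prop :=
  (exists2 u, u \in unzip1 h & sink s u) \/
  (exists u v, [/\ u \in unzip1 h, v \in unzip1 h & clash s u v]).

Definition run_solves n (a : strategy n) (s : outmap n) : Prop :=
  exists2 k, a (transcript a s k) = None & succeeds s (transcript a s k).

(* +oo on a run that never halts. *)
Definition nqueries (R : realType) n (a : strategy n) (s : outmap n) : \bar R :=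
  ereal_sup [set ((size (transcript a s k))%:R)%:E | k in [set: nat]].

(* A randomized algorithm is a random strategy; the probability space of its
   random bits is arbitrary. *)
Record randalg (R : realType) (n : nat) := RandAlg {
  ra_disp : measure_display;
  ra_space : measurableType ra_disp;
  ra_prob : probability ra_space R;
  ra_strategy : ra_space -> strategy n;
  ra_measurable : forall (h : history n) (o : option (word n)),
    measurable [set w | ra_strategy w h = o]
}.

Definition solves_sink_or_clash (R : realType) n (A : randalg R n) : Prop :=
  forall s : outmap n,
    {ae ra_prob A, forall w, run_solves (ra_strategy w) s}.

Definition expected_queries (R : realType) n (A : randalg R n)
    (s : outmap n) : \bar R :=
  (\int[ra_prob A]_w nqueries R (ra_strategy w) s)%E.

Definition worst_case (R : realType) n (A : randalg R n) : \bar R :=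
  \big[maxe/-oo%E]_(s : outmap n) expected_queries A s.

Definition is_min (R : realType) (C : set (\bar R)) (c : \bar R) : Prop :=
  C c /\ forall c', C c' -> (c <= c')%E.

Definition worst_costs (R : realType) (n : nat) : set (\bar R) :=
  [set c | exists A : randalg R n, solves_sink_or_clash A /\ worst_case A = c].

(* The junk value -oo, which is never a cost, is taken only when the minimum
   over the algorithms is not attained. *)
Definition ttilde (R : realType) (n : nat) : \bar R :=
  xget -oo%E [set c | is_min (@worst_costs R n) c].

(* Main.v *)
Require Import Defs.
From mathcomp Require Import all_boot all_order all_algebra.
From mathcomp Require Import all_classical all_reals all_analysis.
Local Open Scope ring_scope.

(** If both outputs are 1, the only success is the clash of the two vertices of
    the 1-cube, so two queries are needed almost surely.  Conversely, querying
    both vertices always succeeds: either one of them is a sink, or both outputs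
    are 1. *)

Import Order.TTheory GRing.Theory Num.Theory.
Set Implicit Arguments.
Unset Strict Implicit.
Unset Printing Implicit Defensive.
Local Open Scope classical_set_scope.

(* Unlike in [ge0_le_integral], no measurability is required. *)
Lemma ge0_le_integral_patch d (T : measurableType d) (R : realType)
    (mu : measure T R) (D E : set T) (f g : T -> \bar R) :
  (forall x, D x -> (0 <= f x)%E) -> (forall x, E x -> (0 <= g x)%E) ->
  (forall x, ((f \_ D) x <= (g \_ E) x)%E) ->
  (\int[mu]_(x in D) f x <= \int[mu]_(x in E) g x)%E.
Proof.
move=> f0 g0 fg; rewrite !ge0_integralE//; apply: ereal_sup_le => _ [h hf <-].
by exists h => //= x; apply: le_trans (hf x) (fg x).
Qed.

Lemma measurable_const_set d (T : measurableType d) (P : Prop) :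
  measurable [set _ : T | P].
Proof.
by have [/propT ->|/propF ->] := pselect P;
  [exact: measurableT | exact: measurable0].
Qed.

Section Transcript.
Variables (n : nat) (s : outmap n).
Implicit Types a : strategy n.

Lemma size_transcript_le a k : (size (transcript a s k) <= k)%N.
Proof.
by elim: k => //= k IH; case: (a _) => [u|]; rewrite ?size_rcons ?ltnS ?leqW.
Qed.

(** Each round appends one entry unless the strategy halts. A length other than [k] thus reveals an
    earlier halt, after which the history is frozen and the answer on it stays [None]. *)
Lemma transcript_halted a k :
  size (transcript a s k) != k -> a (transcript a s k) = None.
Proof.
elim: k => //= k IH; case E: (a (transcript a s k)) => [u|] //.
by rewrite size_rcons eqSS => /IH; rewrite E.
Qed.

(** Moves a bound on the length at the unknown halting round [k] to the fixed round [m], where it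
    becomes a measurable event. *)
Lemma size_transcript_full a k m :
  (m <= size (transcript a s k))%N -> size (transcript a s m) = m.
Proof.
elim: k => [|k IH]; first by rewrite leqn0 => /eqP ->.
case: (ltngtP m k.+1) => [mk|km|->] le_m.
- apply: IH; move: le_m => /=.
  case E: (a (transcript a s k)) => [u|] // _.
  have [->//|/transcript_halted] := eqVneq (size (transcript a s k)) k.
  by rewrite E.
- by move: km; rewrite ltnNge (leq_trans le_m (size_transcript_le _ _)).
- by apply/eqP; rewrite eqn_leq le_m size_transcript_le.
Qed.

Lemma measurable_transcript (R : realType) (A : randalg R n) k
    (P : set (history n)) :
  measurable [set w : ra_space A | P (transcript (ra_strategy w) s k)].
Proof.
elim: k P => [|k IH] P /=; first exact: measurable_const_set.
(* Split by the history [h] after [k] rounds and the next move [o]. Both range over countable types,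
   and once they are fixed the last condition is constant in [w]. *)
rewrite (_ : [set w | _] = \bigcup_(h : history n) \bigcup_(o : option (word n))
  ([set w : ra_space A | transcript (ra_strategy w) s k = h] `&`
   ([set w : ra_space A | ra_strategy w h = o] `&`
    [set w : ra_space A | P (if o is Some u then rcons h (u, s u) else h)])));
  last first.
  apply/seteqP; split => [w Pw|w [h _ [q _ [ <- [ <- Ph]]]]] //.
  exists (transcript (ra_strategy w) s k) => //.
  by exists (ra_strategy w (transcript (ra_strategy w) s k)).
apply: countable_bigcupT_measurable => [|h]; first exact: countableP.
apply: countable_bigcupT_measurable => [|o]; first exact: countableP.
apply: measurableI; first exact: (IH [set h]).
by apply: measurableI; [exact: ra_measurable | exact: measurable_const_set].
Qed.

(** The number of queries dominates [m] times the indicator of the event [E] that each of the first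
    [m] rounds makes a query, and [E] has probability 1. *)
Lemma expected_queries_ge (R : realType) (A : randalg R n) m :
  {ae ra_prob A, forall w, run_solves (ra_strategy w) s} ->
  (forall h, succeeds s h -> (m <= size h)%N) ->
  (m%:R%:E <= expected_queries A s)%E.
Proof.
move=> Asolves hm.
set E := [set w : ra_space A | size (transcript (ra_strategy w) s m) = m].
have mE : measurable E.
  exact: (measurable_transcript A m [set h | size h = m]).
have PE : ra_prob A E = 1%E.
  apply/eqP; rewrite -[E]setCK probability_setC; last exact: measurableC.
  rewrite (measure_negligible (measurableC mE)) ?sube0//.
  (* Outside [E] the run cannot solve: a successful history would have at least [m] entries. *)
  apply: negligibleS Asolves => w /= nE [k _ ok]; apply: nE.
  exact: size_transcript_full (hm _ ok).
rewrite -[X in (X <= _)%E]mule1 -PE -integral_cst//.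
apply: ge0_le_integral_patch => [w _|w _|w].
- by rewrite lee_fin.
- by apply: ereal_sup_ubound; exists 0%N.
- rewrite patch_setT /patch; case: ifPn => [/set_mem Ew|_].
    by apply: ereal_sup_ubound; exists m; rewrite ?Ew.
  by apply: ereal_sup_ubound; exists 0%N.
Qed.

Lemma expected_queries_le (R : realType) (A : randalg R n) m :
  (forall (w : ra_space A) k, (size (transcript (ra_strategy w) s k) <= m)%N) ->
  (expected_queries A s <= m%:R%:E)%E.
Proof.
move=> hm; rewrite -[X in (_ <= X)%E]mule1 -(probability_setT (ra_prob A)).
rewrite -integral_cst//; apply: ge0_le_integral_patch => [w _|w _|w].
- by apply: ereal_sup_ubound; exists 0%N.
- by rewrite lee_fin.
- rewrite !patch_setT; apply: ge_ereal_sup => _ [k _ <-].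
  by rewrite lee_fin ler_nat.
Qed.

(** Success can only come from a clash, whose two distinct vertices both occur in the history. *)
Lemma sinkless_succeeds_size h :
  (forall u, ~~ sink s u) -> succeeds s h -> (1 < size h)%N.
Proof.
move=> nosink [[u _]|[u [v [uh vh /andP[uv _]]]]].
  by rewrite (negPf (nosink u)).
rewrite -(size_map fst) -/(unzip1 h).
have uniq_uv : uniq [:: u; v] by rewrite /= inE uv.
by apply: (uniq_leq_size uniq_uv) => x; rewrite !inE => /orP[] /eqP ->.
Qed.

End Transcript.

Lemma worst_case_ge {R : realType} {n} (A : randalg R n) s :
  (expected_queries A s <= worst_case A)%E.
Proof. exact: (le_bigmax _ (expected_queries A)). Qed.

Definition const_word n (b : bool) : word n := [ffun=> b].

Lemma sink1E (s : outmap 1) u : sink s u = ~~ s u ord0.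
Proof.
apply/eqP/idP => [->|su]; first by rewrite ffunE.
by apply/ffunP => i; rewrite !ffunE ord1 (negPf su).
Qed.

(** Non-adaptive: only the length of the history matters, and the default [None] of [nth] makes it
    halt after two queries. *)
Definition both_queries : strategy 1 := fun h =>
  nth None [:: Some (const_word 1 false); Some (const_word 1 true)] (size h).

Lemma both_queries_size s k : (size (transcript both_queries s k) <= 2)%N.
Proof.
elim: k => //= k IH; case E: (both_queries _) => [u|] //.
rewrite size_rcons ltnNge; apply/negP => le2.
by move: E; rewrite {1}/both_queries nth_default.
Qed.

Lemma both_queries_solve s : run_solves both_queries s.
Proof.
exists 2%N => //=; rewrite /both_queries /=.
set u := const_word 1 false; set v := const_word 1 true.
have [su|nsu] := boolP (sink s u).
  by left; exists u => //; rewrite inE eqxx.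
have [sv|nsv] := boolP (sink s v).
  by left; exists v => //; rewrite !inE eqxx orbT.
right; exists u, v; split; rewrite ?inE ?eqxx ?orbT//; apply/andP; split.
  by apply/eqP => /ffunP/(_ ord0); rewrite !ffunE.
(* Neither vertex is a sink, so both output bits are 1 and their XOR vanishes. *)
apply/eqP/ffunP => i; rewrite !ffunE !ord1.
by move: nsu nsv; rewrite !sink1E !negbK => -> ->.
Qed.

(** A deterministic strategy is a random one over a one-point space, all of whose subsets are
    measurable. *)
Definition both_queries_alg (R : realType) : randalg R 1 :=
  @RandAlg R 1 _ unit (dirac tt) (fun=> both_queries) (fun _ _ => I).

Lemma both_queries_alg_solves (R : realType) :
  solves_sink_or_clash (both_queries_alg R).
Proof. by move=> s; apply: aeW => w; exact: both_queries_solve. Qed.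

Lemma both_queries_alg_cost (R : realType) :
  (worst_case (both_queries_alg R) <= 2%:E)%E.
Proof.
apply: bigmax_le => [|s _]; first exact: leNye.
by apply: expected_queries_le => w k; exact: both_queries_size.
Qed.

Lemma worst_case1_ge2 (R : realType) (A : randalg R 1) :
  solves_sink_or_clash A -> (2%:E <= worst_case A)%E.
Proof.
move=> /(_ [ffun=> const_word 1 true]) Asolves.
apply: le_trans (worst_case_ge A [ffun=> const_word 1 true]).
apply: expected_queries_ge Asolves _ => h; apply: sinkless_succeeds_size => u.
by rewrite sink1E !ffunE.
Qed.

Theorem lemma28 (R : realType) : ttilde R 1 = 2%:E.
Proof.
have lb (c : \bar R) : worst_costs 1 c -> (2%:E <= c)%E.
  by move=> [A [Asolves <-]]; exact: worst_case1_ge2.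
have c2 : @worst_costs R 1 2%:E.
  exists (both_queries_alg R); split; first exact: both_queries_alg_solves.
  apply/eqP; rewrite eq_le both_queries_alg_cost worst_case1_ge2//.
  exact: both_queries_alg_solves.
(* A minimum is unique by antisymmetry, so [xget] must return 2. *)
apply: xget_unique => // c [cc cmin].
by apply/eqP; rewrite eq_le cmin// lb.
Qed.
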